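(* Suppose that the random vector $(X,Y)$ has a bivariate continuous distribution with a continuous density function $f$ with support $\overline{f^{-1}((0,\infty))} = [a,b]\times[c,d]$, where $-\infty\le a<b\le\infty$ and $-\infty\le c<d\le\infty$. Let $(X_1,Y_1),\dots,(X_4,Y_4)$ be i.i.d. copies of $(X,Y)$. If $X$ and $Y$ are dependent, then $\sigma_1^2 = \operatorname{Var}[h_1(X_1,Y_1)] > 0$.
   Context: The bar denotes topological closure; intervals with infinite endpoints are understood as the corresponding closed subsets of $\mathbb{R}$. For $z_1,\dots,z_4\in\mathbb{R}$ let $$a(z_1,z_2,z_3,z_4) = I(z_1,z_3<z_2,z_4) + I(z_1,z_3>z_2,z_4) - I(z_1,z_2<z_3,z_4) - I(z_1,z_2>z_3,z_4),$$ where $I(\cdot)$ is the indicator function, $p,q<r,s$ is shorthand for $\max(p,q)<\min(r,s)$, and $p,q>r,s$ is shorthand for $\min(p,q)>\max(r,s)$ (the function $a$ is not to be confused with the interval endpoint $a$). For a permutation $\pi$ in $S_4$ (the permutations of $\{1,2,3,4\}$) write $z_{\pi(1,2,3,4)}=(z_{\pi(1)},z_{\pi(2)},z_{\pi(3)},z_{\pi(4)})$, and define the symmetric kernel $$h((x_1,y_1),\dots,(x_4,y_4)) = \frac{1}{4!}\sum_{\pi\in S_4} a(x_{\pi(1,2,3,4)})\,a(y_{\pi(1,2,3,4)}).$$ Define $h_1(x_1,y_1) = \mathrm{E}[h((x_1,y_1),(X_2,Y_2),(X_3,Y_3),(X_4,Y_4))]$. *)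

(* Defs.v *)
From HB Require Import structures.
From mathcomp Require Import all_boot all_order all_algebra perm.
From mathcomp Require Import all_classical all_reals all_analysis.

Set Implicit Arguments.
Unset Strict Implicit.
Unset Printing Implicit Defensive.

Import Order.TTheory GRing.Theory Num.Theory.
Import numFieldNormedType.Exports.

Local Open Scope classical_set_scope.
Local Open Scope ring_scope.

Section Kernel.
Context {R : realType}.

(* [lt2] and [gt2] are the indicators I(p, q < r, s) and I(p, q > r, s). *)
Definition lt2 (p q r s : R) : R := (Num.max p q < Num.min r s)%R%:R.

Definition gt2 (p q r s : R) : R := (Num.min p q > Num.max r s)%R%:R.

Definition sign_a (z1 z2 z3 z4 : R) : R :=
  lt2 z1 z3 z2 z4 + gt2 z1 z3 z2 z4 - lt2 z1 z2 z3 z4 - gt2 z1 z2 z3 z4.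

(* The indices 1, 2, 3, 4 are the elements 0, 1, 2, 3 of 'I_4. *)
Definition sign_a_perm (z : 'I_4 -> R) (s : 'S_4) : R :=
  sign_a (z (s (inord 0))) (z (s (inord 1))) (z (s (inord 2))) (z (s (inord 3))).

Definition kernel_h (p1 p2 p3 p4 : R * R) : R :=
  let p := tnth [tuple p1; p2; p3; p4] in
  (4`!)%:R^-1 * \sum_(s : 'S_4) sign_a_perm (fun i => (p i).1) s *
                                sign_a_perm (fun i => (p i).2) s.

End Kernel.

Section Probability.
Context {R : realType} {d} {T : measurableType d} (P : probability T R).

Definition independent_pair {d1 d2} {T1 : measurableType d1}
    {T2 : measurableType d2} (X : T -> T1) (Y : T -> T2) : Prop :=
  forall A B, measurable A -> measurable B ->
    (P (X @^-1` A `&` Y @^-1` B) = P (X @^-1` A) * P (Y @^-1` B))%E.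

Definition mutually_independent {d1} {T1 : measurableType d1} {I : finType}
    (Z : I -> T -> T1) : Prop :=
  forall (J : {set I}) (A : I -> set T1), (forall i, measurable (A i)) ->
    (P (\bigcap_(i in [set` J]) (Z i @^-1` A i)) =
     \prod_(i in J) P (Z i @^-1` A i))%E.

(* Density with respect to the Lebesgue measure on the plane. *)
Definition is_density (Z : {RV P >-> (R * R)%type}) (f : R * R -> R) : Prop :=
  [/\ measurable_fun setT f, forall z, 0 <= f z &
      forall A, measurable A ->
        distribution P Z A =
        (\int[(@lebesgue_measure R) \x (@lebesgue_measure R)]_(z in A)
            (f z)%:E)%E].

(* In [iid_copies], [Z] may live on another probability space than [Z0]. *)
Definition iid_copies {d0} {T0 : measurableType d0} (P0 : probability T0 R)
    {d1} {T1 : measurableType d1} {I : finType}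
    (Z0 : {RV P0 >-> T1}) (Z : I -> {RV P >-> T1}) : Prop :=
  mutually_independent (fun i => Z i : T -> T1) /\
  forall i A, measurable A -> distribution P (Z i) A = distribution P0 Z0 A.

(* [h1]; the kernel is bounded, so the expectation is finite. *)
Definition proj_h1 (Z : 'I_4 -> {RV P >-> (R * R)%type}) (p : R * R) : R :=
  fine 'E_P[fun w => kernel_h p (Z (inord 1) w) (Z (inord 2) w)
                                (Z (inord 3) w)].

End Probability.

(* Main.v *)
Require Import Defs.
From HB Require Import structures.
From mathcomp Require Import all_boot all_order all_algebra perm.
From mathcomp Require Import all_classical all_reals all_analysis.
From mathcomp Require Import measurable_realfun ring lra.
Import Order.TTheory GRing.Theory Num.Theory.
Import numFieldNormedType.Exports.

Set Implicit Arguments.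
Unset Strict Implicit.
Unset Printing Implicit Defensive.

Local Open Scope classical_set_scope.
Local Open Scope ring_scope.

(** Why the variance is positive.

    Four distinct reals are split by their order into a lower and an upper
    pair, and a(z1,z2,z3,z4) only depends on which of the three partitions into
    pairs this is.  Averaging over S_4 gives, away from ties,
    h = 1(same partition for the x and for the y) - 1/3.  So h1(x,y) + 1/3 is
    three times the probability that x,X2 | X3,X4 and y,Y2 | Y3,Y4 are both
    separated.

    Let F be the joint distribution function, F1 and F2 its marginals, and
    G = F - F1 F2.  If the variance vanishes, h1 is almost surely constant.  The
    kernel jumps only at ties, which are null events because the marginals have
    no atoms, so h1 is continuous.  A null set cannot contain a nonempty open
    subset of {f > 0}, so h1 is constant on the closure of {f > 0}, which is a rectangle
    of full probability.  Since it is a rectangle, h1 takes the same value at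
    (X1,Y1) and at (X1,Y5) with Y5 from an independent copy.

    The heart of the proof is the identity (kernel_proj_dependence)

      E h1(X1,Y1) - E h1(X1,Y5) = 9 (E G(X1,Y1)^2 + E G(X1,Y5)^2),

    an integration by parts of h1 against the signed measure dF - dF1 dF2.
    Formally, in the coordinates u = F1(x), v = F2(y), the mixed derivative of
    h1 is 6 (3 G + 2 G G_uv + G_u G_v); integrating it against G and using
    that the integral of G G_u G_v is minus half that of G^2 G_uv leaves
    9 times the integral of G^2 (2 + G_uv), and 1 + G_uv is the copula density.
    No derivative appears in the actual proof: every step is an exchange of
    integrals over independent copies.  Integrating points 1, 5 and 2 first
    leaves G, and the term playing the role of G_u G_v is computed in
    E_cdf_gap_fluctuation from the product rule cdf_gap_sqr.

    Hence a constant h1 forces E G(X1,Y5)^2 = 0.  The product rule bounds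
    G(x,y)^2 by 2 E |G(X,y)| and by 2 E |G(x,Y)|, so G vanishes at every point,
    and X and Y are independent. *)

(** * Integration of bounded measurable functions *)

Section BoundedMeasurable.
Context {R : realType}.

(** All integrands of the proof are bounded and measurable. This class is stable
    under algebraic operations and under integrating out a variable, so that
    integrability and the conditions of Fubini's theorem reduce to syntax. *)
Definition bmfun d (T : measurableType d) (g : T -> R) : Prop :=
  measurable_fun setT g /\ exists M, forall z, `|g z| <= M.

Definition ind (s r : R) : R := (s < r)%R%:R.

Section Closure.
Context d (T : measurableType d).
Implicit Types g h : T -> R.

Lemma bmfun_cst (c : R) : bmfun (fun _ : T => c).
Proof. by split; [exact: measurable_cst|exists `|c|]. Qed.

Lemma bmfunD g h : bmfun g -> bmfun h -> bmfun (fun z => g z + h z).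
Proof.
move=> [mg [M gM]] [mh [N hN]]; split; first exact: measurable_funD.
by exists (M + N) => z; rewrite (le_trans (ler_normD _ _))// lerD.
Qed.

Lemma bmfunN g : bmfun g -> bmfun (fun z => - g z).
Proof.
move=> [mg [M gM]]; split; first exact: measurableT_comp.
by exists M => z; rewrite normrN.
Qed.

Lemma bmfunM g h : bmfun g -> bmfun h -> bmfun (fun z => g z * h z).
Proof.
move=> [mg [M gM]] [mh [N hN]]; split; first exact: measurable_funM.
by exists (M * N) => z; rewrite normrM ler_pM.
Qed.

Lemma bmfunX g n : bmfun g -> bmfun (fun z => g z ^+ n).
Proof.
move=> [mg [M gM]]; split; first exact: measurable_funX.
by exists (M ^+ n) => z; rewrite normrX lerXn2r// nnegrE// (le_trans _ (gM z)).
Qed.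

Lemma bmfun_norm g : bmfun g -> bmfun (fun z => `|g z|).
Proof.
move=> [mg [M gM]]; split; first exact: measurableT_comp.
by exists M => z; rewrite normr_id.
Qed.

Lemma bmfun_ind g h : measurable_fun setT g -> measurable_fun setT h ->
  bmfun (fun z => ind (g z) (h z)).
Proof.
move=> mg mh; split; last first.
  by exists 1 => z; rewrite /ind; case: (_ < _); rewrite ?normr1 ?normr0.
rewrite (_ : (fun z => _) = \1_[set z | g z < h z]); last first.
  by apply/funext => z; rewrite indicE /ind; congr (_%:R : R);
     case: (boolP (g z < h z)) => gh; [rewrite mem_set|rewrite memNset//=; exact/negP].
apply: measurable_indic.
have := measurable_fun_ltr mg mh => /(_ measurableT [set true]).
by rewrite setTI; apply.
Qed.

End Closure.

Lemma bmfun_comp d1 d2 (T1 : measurableType d1) (T2 : measurableType d2)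
    (k : T2 -> T1) (g : T1 -> R) :
  bmfun g -> measurable_fun setT k -> bmfun (fun z => g (k z)).
Proof.
move=> [mg [M gM]] mk; split; first exact: (measurableT_comp mg mk).
by exists M.
Qed.

Section Integral.
Context d (T : measurableType d) (m : probability T R).
Implicit Types g h : T -> R.
Local Notation E := (Rintegral m setT).

Lemma bmfun_integrable g : bmfun g -> m.-integrable setT (EFin \o g).
Proof.
move=> [mg [M gM]]; apply: (@le_integrable _ _ _ _ _ _ _ (cst M%:E)) => //.
- exact/measurable_EFinP.
- by move=> z _ /=; rewrite lee_fin (le_trans (gM z))// ler_norm.
- exact/finite_measure_integrable_cst.
Qed.

Lemma bmfun_EFin_E g : bmfun g -> (E g)%:E = (\int[m]_z (g z)%:E)%E.
Proof.
by move=> bg; rewrite /Rintegral fineK//; apply: integrable_fin_num => //; exact: bmfun_integrable.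
Qed.

Lemma eq_E g h : g =1 h -> E g = E h.
Proof. by move=> gh; congr (E _); apply/funext. Qed.

Lemma E_cst (c : R) : E (fun=> c) = c.
Proof. by rewrite Rintegral_cst// [X in fine X](@probability_setT _ _ _ m) mulr1. Qed.

Lemma E_D g h : bmfun g -> bmfun h -> E (fun z => g z + h z) = E g + E h.
Proof. by move=> bg bh; rewrite RintegralD//; exact: bmfun_integrable. Qed.

Lemma E_B g h : bmfun g -> bmfun h -> E (fun z => g z - h z) = E g - E h.
Proof. by move=> bg bh; rewrite RintegralB//; exact: bmfun_integrable. Qed.

Lemma E_Zl c g : bmfun g -> E (fun z => c * g z) = c * E g.
Proof. by move=> bg; rewrite RintegralZl//; exact: bmfun_integrable. Qed.

Lemma E_Zr c g : bmfun g -> E (fun z => g z * c) = E g * c.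
Proof. by move=> bg; rewrite RintegralZr//; exact: bmfun_integrable. Qed.

Lemma E_lin u v g h : bmfun g -> bmfun h ->
  E (fun z => u * g z + v * h z) = u * E g + v * E h.
Proof.
move=> bg bh; rewrite -!E_Zl// -E_D//; apply: bmfunM => //; exact: bmfun_cst.
Qed.

Lemma E_le g h : bmfun g -> bmfun h -> (forall z, g z <= h z) -> E g <= E h.
Proof. by move=> bg bh gh; apply: le_Rintegral => //; exact: bmfun_integrable. Qed.

Lemma E_ge0 g : (forall z, 0 <= g z) -> 0 <= E g.
Proof. by move=> g0; apply: Rintegral_ge0. Qed.

Lemma E_norm g : bmfun g -> `|E g| <= E (fun z => `|g z|).
Proof. by move=> bg; apply: le_normr_Rintegral => //; exact: bmfun_integrable. Qed.

Lemma E_ae g h : bmfun g -> bmfun h -> {ae m, forall z, g z = h z} -> E g = E h.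
Proof.
move=> [mg _] [mh _] gh; congr fine; apply: ae_eq_integral => //.
- exact/measurable_EFinP.
- exact/measurable_EFinP.
- by apply: filterS gh => z /= ->.
Qed.

End Integral.

Section Sections.
Context d1 d2 (T1 : measurableType d1) (T2 : measurableType d2).

Lemma bmfun_sec (g : T1 -> T2 -> R) x :
  bmfun (fun w : T1 * T2 => g w.1 w.2) -> bmfun (g x).
Proof.
move=> bg; apply: (@bmfun_comp _ _ _ _ (fun y => (x, y)) _ bg).
exact: measurable_pair1.
Qed.

End Sections.

Section PartialIntegral.
Context d1 d2 (T1 : measurableType d1) (T2 : measurableType d2).
Variable m2 : probability T2 R.

(** Adding a bound of g makes the integrand nonnegative, so Tonelli's theorem
    gives the measurability without any measure on the first factor. *)
Lemma bmfun_E (g : T1 -> T2 -> R) : bmfun (fun w : T1 * T2 => g w.1 w.2) ->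
  bmfun (fun x => Rintegral m2 setT (g x)).
Proof.
move=> bg; split; last first.
  have [_ [M gM]] := bg; exists M => x.
  have bx := bmfun_sec x bg.
  rewrite (le_trans (E_norm _ bx))// -[leRHS](E_cst m2).
  apply: E_le; [exact: bmfun_norm|exact: bmfun_cst|].
  by move=> y; exact: (gM (x, y)).
have [_ [M gM]] := bg.
have bgM : bmfun (fun w : T1 * T2 => (fun x y => g x y + M) w.1 w.2).
  by apply: bmfunD bg _; exact: bmfun_cst.
rewrite (_ : (fun x => _) = fun x => Rintegral m2 setT (fun y => g x y + M) - M); last first.
  apply/funext => x; rewrite E_D; [|exact: bmfun_sec|exact: bmfun_cst].
  by rewrite E_cst addrK.
apply: measurable_funB => //; apply/measurable_EFinP.
rewrite [X in measurable_fun _ X](_ : _ = fun x => (\int[m2]_y (g x y + M)%:E)%E); last first.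
  apply/funext => x /=; rewrite bmfun_EFin_E//.
  exact: (@bmfun_sec _ _ _ _ (fun x y => g x y + M) x bgM).
apply: (@measurable_fun_fubini_tonelli_F _ _ _ _ _ m2 (fun w : T1 * T2 => (g w.1 w.2 + M)%:E)).
- by apply/measurable_EFinP; case: bgM.
- by move=> [x y]; rewrite lee_fin -lerBlDr sub0r lerNl (le_trans _ (gM (x, y)))// -normrN ler_norm.
Qed.

End PartialIntegral.

Section ProductIntegral.
Context d1 d2 (T1 : measurableType d1) (T2 : measurableType d2).
Variables (m1 : probability T1 R) (m2 : probability T2 R).

Lemma E_prod (g : T1 -> T2 -> R) : bmfun (fun w : T1 * T2 => g w.1 w.2) ->
  Rintegral (m1 \x m2)%E setT (fun w => g w.1 w.2) =
  Rintegral m1 setT (fun x => Rintegral m2 setT (g x)).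
Proof.
move=> bg; apply: EFin_inj; rewrite !bmfun_EFin_E//; last exact: bmfun_E.
rewrite -(integral12_prod_meas1 (bmfun_integrable (m1 \x m2)%E bg)).
by apply: eq_integral => x _; rewrite bmfun_EFin_E//; exact: bmfun_sec.
Qed.

Lemma E_swap (g : T1 -> T2 -> R) : bmfun (fun w : T1 * T2 => g w.1 w.2) ->
  Rintegral m1 setT (fun x => Rintegral m2 setT (fun y => g x y)) =
  Rintegral m2 setT (fun y => Rintegral m1 setT (fun x => g x y)).
Proof.
move=> bg; have bg' : bmfun (fun w : T2 * T1 => g w.2 w.1).
  apply: (@bmfun_comp _ _ _ _ (fun w => (w.2, w.1)) _ bg).
  by apply: measurable_fun_pair; [exact: measurable_snd|exact: measurable_fst].
apply: (@EFin_inj R); rewrite !bmfun_EFin_E//; last 2 first.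
- exact: (@bmfun_E _ _ _ _ _ (fun y x => g x y) bg').
- exact: (bmfun_E _ bg).
transitivity (\int[m1]_x \int[m2]_y (g x y)%:E)%E.
  by apply: eq_integral => x _; rewrite bmfun_EFin_E//; exact: bmfun_sec.
rewrite (Fubini (bmfun_integrable (m1 \x m2)%E bg)).
apply: eq_integral => y _; rewrite bmfun_EFin_E//.
exact: (@bmfun_sec _ _ _ _ (fun y x => g x y) y bg').
Qed.

End ProductIntegral.

Section MeasurableComposition.
Context d d1 d2 (T : measurableType d) (T1 : measurableType d1)
  (T2 : measurableType d2).

Lemma mfun_comp (f : T1 -> T2) (k : T -> T1) : measurable_fun setT f ->
  measurable_fun setT k -> measurable_fun setT (fun z => f (k z)).
Proof. by move=> mf mk; exact: (measurableT_comp mf mk). Qed.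

Lemma mfun_fst (k : T -> T1 * T2) : measurable_fun setT k ->
  measurable_fun setT (fun z => (k z).1).
Proof. by move=> mk; exact: (measurableT_comp measurable_fst mk). Qed.

Lemma mfun_snd (k : T -> T1 * T2) : measurable_fun setT k ->
  measurable_fun setT (fun z => (k z).2).
Proof. by move=> mk; exact: (measurableT_comp measurable_snd mk). Qed.

End MeasurableComposition.
End BoundedMeasurable.

Ltac mfun :=
  repeat first
    [ exact: measurable_cst | exact: measurable_id
    | match goal with
      | H : measurable_fun setT ?X |- measurable_fun _ (fun w => ?X (@?k w)) =>
        refine (mfun_comp H _)
      end
    | match goal with
      | |- measurable_fun _ (fun w => (@?a w, @?b w)) =>
        apply: measurable_fun_pair
      end
    | apply: mfun_fst | apply: mfun_snd ].

(** Entry point of the tactic below for functions defined later. *)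
Ltac bmfun_leaf := fail.

Ltac bmfun :=
  repeat lazymatch goal with
  | |- bmfun (fun _ => ?c) => exact: bmfun_cst
  | |- bmfun (fun w => @?f w + @?g w) => apply: bmfunD
  | |- bmfun (fun w => - @?f w) => apply: bmfunN
  | |- bmfun (fun w => @?f w * @?g w) => apply: bmfunM
  | |- bmfun (fun w => @?f w ^+ ?n) => apply: bmfunX
  | |- bmfun (fun w => `| @?f w |) => apply: bmfun_norm
  | |- bmfun (fun w => ind (@?f w) (@?g w)) => apply: bmfun_ind; mfun
  | |- bmfun (fun w => Rintegral ?m setT (@?g w)) => apply: bmfun_E
  | |- bmfun ?f => first [ bmfun_leaf
                  | lazymatch f with
                    | (fun _ => _) => fail
                    | _ => change (bmfun (fun w => f w))
                    end
                  | match goal with H : _ |- _ => solve [apply: H; mfun] end ]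
  end.

(** * The kernel in terms of separated pairs *)

Section KernelAlgebra.
Context {R : realType}.

(** The event that the pairs z1,z2 and z3,z4 are separated, as a polynomial in
    elementary comparisons: in this form, symmetries, measurability and
    continuity can be read off. *)
Definition sep (z1 z2 z3 z4 : R) : R :=
  ind z1 z3 * ind z1 z4 * ind z2 z3 * ind z2 z4 +
  ind z3 z1 * ind z4 z1 * ind z3 z2 * ind z4 z2.

Lemma lt2E (p q r s : R) : lt2 p q r s = ind p r * ind p s * ind q r * ind q s.
Proof.
rewrite /lt2 /ind -!natrM gt_max !lt_min; congr (_%:R).
by do 4 case: (_ < _).
Qed.

Lemma gt2E (p q r s : R) : gt2 p q r s = ind r p * ind s p * ind r q * ind s q.
Proof.
rewrite /gt2 /ind -!natrM gt_max !lt_min; congr (_%:R).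
by do 4 case: (_ < _).
Qed.

Lemma sign_aE (z1 z2 z3 z4 : R) : sign_a z1 z2 z3 z4 = sep z1 z3 z2 z4 - sep z1 z2 z3 z4.
Proof. by rewrite /sign_a !lt2E !gt2E /sep opprD addrA. Qed.

(** The 24 orders of the arguments yield only the three partitions into pairs;
    each is oriented towards its representative beginning with z1. *)
Lemma sep_sym (z1 z2 z3 z4 : R) :
  (sep z1 z2 z4 z3 = sep z1 z2 z3 z4) *
  (sep z1 z3 z4 z2 = sep z1 z3 z2 z4) *
  (sep z1 z4 z3 z2 = sep z1 z4 z2 z3) *
  (sep z2 z1 z3 z4 = sep z1 z2 z3 z4) *
  (sep z2 z1 z4 z3 = sep z1 z2 z3 z4) *
  (sep z2 z3 z1 z4 = sep z1 z4 z2 z3) *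
  (sep z2 z3 z4 z1 = sep z1 z4 z2 z3) *
  (sep z2 z4 z1 z3 = sep z1 z3 z2 z4) *
  (sep z2 z4 z3 z1 = sep z1 z3 z2 z4) *
  (sep z3 z1 z2 z4 = sep z1 z3 z2 z4) *
  (sep z3 z1 z4 z2 = sep z1 z3 z2 z4) *
  (sep z3 z2 z1 z4 = sep z1 z4 z2 z3) *
  (sep z3 z2 z4 z1 = sep z1 z4 z2 z3) *
  (sep z3 z4 z1 z2 = sep z1 z2 z3 z4) *
  (sep z3 z4 z2 z1 = sep z1 z2 z3 z4) *
  (sep z4 z1 z2 z3 = sep z1 z4 z2 z3) *
  (sep z4 z1 z3 z2 = sep z1 z4 z2 z3) *
  (sep z4 z2 z1 z3 = sep z1 z3 z2 z4) *
  (sep z4 z2 z3 z1 = sep z1 z3 z2 z4) *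
  (sep z4 z3 z1 z2 = sep z1 z2 z3 z4) *
  (sep z4 z3 z2 z1 = sep z1 z2 z3 z4).
Proof. by rewrite /sep; do !split; ring. Qed.

(** Turns the sum over the abstract group S_4 into a sum over an explicit list
    of 24 lists of numbers. *)
Lemma perm_eq_permutations4 :
  perm_eq [seq [seq val (s i) | i <- [:: inord 0; inord 1; inord 2; inord 3]]
             | s : 'S_4 <- enum {: 'S_4}]
          (permutations (iota 0 4)).
Proof.
have iE : [:: inord 0; inord 1; inord 2; inord 3] = enum 'I_4.
  apply: (inj_map val_inj); rewrite val_enum_ord /=.
  by rewrite !inordK.
rewrite iE; set S := map _ _.
have uS : uniq S.
  rewrite map_inj_uniq ?enum_uniq// => s t st; apply/permP => i.
  apply: val_inj; have /eq_in_map := st; apply.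
  by rewrite mem_enum.
apply: uniq_perm => //.
apply: (uniq_min_size uS _ _).2 => [l /mapP[s _ ->]|].
  rewrite mem_permutations; apply: uniq_perm.
  - by rewrite map_inj_uniq ?enum_uniq// => i j /val_inj /perm_inj.
  - exact: iota_uniq.
  - move=> k; rewrite mem_iota /=; apply/mapP/idP => [[i _ ->]|k4].
      exact: ltn_ord.
    by exists ((s^-1)%g (Ordinal k4)); rewrite ?mem_enum// permKV.
rewrite size_map -cardE card_Sn size_permutations ?iota_uniq//.
Qed.

Lemma sum_S4 (G : nat -> nat -> nat -> nat -> R) :
  \sum_(s : 'S_4) G (s (inord 0)) (s (inord 1)) (s (inord 2)) (s (inord 3)) =
  \sum_(l <- permutations (iota 0 4)) G (nth 0 l 0) (nth 0 l 1) (nth 0 l 2) (nth 0 l 3).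
Proof.
by rewrite -(perm_big _ perm_eq_permutations4) big_map /= big_enum.
Qed.

(** A permutation acts on the three partitions. In the average over S_4 each
    product of equal partitions gets weight 16/24, and each product of distinct
    partitions weight -8/24; counting the equal
    products in both sums gives the weights 1 and -1/3. *)
Lemma kernel_hE (p1 p2 p3 p4 : R * R) :
  let u1 z := sep (z p1) (z p2) (z p3) (z p4) in
  let u2 z := sep (z p1) (z p3) (z p2) (z p4) in
  let u3 z := sep (z p1) (z p4) (z p2) (z p3) in
  kernel_h p1 p2 p3 p4 =
  u1 fst * u1 snd + u2 fst * u2 snd + u3 fst * u3 snd
  - 3^-1 * (u1 fst + u2 fst + u3 fst) * (u1 snd + u2 snd + u3 snd).
Proof.
move=> u1 u2 u3; rewrite /kernel_h.
pose c i := nth p1 [:: p1; p2; p3; p4] i.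
have cE i : tnth [tuple p1; p2; p3; p4] i = c i.
  by rewrite (tnth_nth p1).
under eq_bigr do rewrite /sign_a_perm !cE !sign_aE.
rewrite (sum_S4 (fun i j k l =>
  (sep (c i).1 (c k).1 (c j).1 (c l).1 - sep (c i).1 (c j).1 (c k).1 (c l).1) *
  (sep (c i).2 (c k).2 (c j).2 (c l).2 - sep (c i).2 (c j).2 (c k).2 (c l).2))).
(* The list of permutations is evaluated once and for all. *)
rewrite (_ : permutations _ =
  (ltac:(let t := eval vm_compute in (permutations (iota 0 4)) in
    exact t)))//.
rewrite !big_cons big_nil /= /c /=.
rewrite !(sep_sym p1.1 p2.1 p3.1 p4.1) !(sep_sym p1.2 p2.2 p3.2 p4.2).
rewrite -/(u1 fst) -/(u2 fst) -/(u3 fst) -/(u1 snd) -/(u2 snd) -/(u3 snd).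
have -> : (4`!)%:R = 24%:R :> R by [].
by field.
Qed.

(** The part of the separation of z1,z2 from r,s in which s is the one of r, s
    closest to the other pair: the lower one if z1,z2 lie below, the upper one
    if they lie above. *)
Definition sep_at (z1 z2 s r : R) : R :=
  (1 - ind r s) * (ind z1 s * ind z2 s) +
  ind r s * ((1 - ind z1 s) * (1 - ind z2 s)).

Lemma sep_sep_at (z1 z2 z3 z4 : R) : z1 != z3 -> z1 != z4 -> z2 != z3 ->
  z2 != z4 -> z3 != z4 ->
  sep z1 z2 z3 z4 = sep_at z1 z2 z3 z4 + sep_at z1 z2 z4 z3.
Proof.
rewrite /sep /sep_at /ind.
by case: (ltgtP z1 z3) => // ? _; case: (ltgtP z1 z4) => // ? _;
  case: (ltgtP z2 z3) => // ? _; case: (ltgtP z2 z4) => // ? _;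
  case: (ltgtP z3 z4) => // ? _ /=; try ring; exfalso; lra.
Qed.

(** Distinct reals are split by their median gap into exactly one pair of pairs,
    so the term of the kernel with factor 1/3 is constant off ties. *)
Lemma sep_partition (z1 z2 z3 z4 : R) : z1 != z2 -> z1 != z3 -> z1 != z4 -> z2 != z3 ->
  z2 != z4 -> z3 != z4 ->
  sep z1 z2 z3 z4 + sep z1 z3 z2 z4 + sep z1 z4 z2 z3 = 1.
Proof.
rewrite /sep /ind.
by case: (ltgtP z1 z2) => // ? _; case: (ltgtP z1 z3) => // ? _; case: (ltgtP z1 z4) => // ? _;
  case: (ltgtP z2 z3) => // ? _; case: (ltgtP z2 z4) => // ? _;
  case: (ltgtP z3 z4) => // ? _ /=; try ring; exfalso; lra.
Qed.

(** Affine in the comparison of z1, with slope the difference of the comparisons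
    of z2 and r. This makes the integrals over z1 and z2 factor. *)
Lemma sep_atE (z1 z2 s r : R) :
  sep_at z1 z2 s r = ind z1 s * (ind z2 s - ind r s) + ind r s * (1 - ind z2 s).
Proof.
by rewrite /sep_at; ring.
Qed.

Lemma sep_atB (z1 z1' z2 s r : R) :
  sep_at z1 z2 s r - sep_at z1' z2 s r = (ind z2 s - ind r s) * (ind z1 s - ind z1' s).
Proof. by rewrite !sep_atE; ring. Qed.

End KernelAlgebra.

(** * The functionals of the proof *)

(** By symmetry between the copies it suffices to follow the partition
    z1,z2 | z3,z4 and the case where z3 is the closest point in the x direction;
    in the y direction the closest point may then be z3 or z4. *)
Definition reduced_kernel {R : realType} {T : Type} (X Y : T -> R) (x y : R) (z2 z3 z4 : T) : R :=
  sep_at x (X z2) (X z3) (X z4) *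
  (sep_at y (Y z2) (Y z3) (Y z4) + sep_at y (Y z2) (Y z4) (Y z3)).

Section Functionals.
Context {R : realType} d (T : measurableType d) (m : probability T R).
Local Notation E := (Rintegral m setT).
Implicit Types (X Y : T -> R) (g h : T -> T -> T -> R).

Definition atomless X := forall s, {ae m, forall z, X z != s}.

Definition lcdf X s := E (fun z => ind (X z) s).

(** The function G = F - F1 F2 of the introduction, with strict inequalities in
    the distribution functions. *)
Definition cdf_gap X Y s t :=
  E (fun z => ind (X z) s * ind (Y z) t) - lcdf X s * lcdf Y t.

Definition E3 g : R := E (fun a => E (fun b => E (fun c => g a b c))).

Definition bmfun3 g := bmfun (fun w : T * T * T => g w.1.1 w.1.2 w.2).

(** The function h1, over a space that carries a single copy of the pair. *)
Definition kernel_proj (X Y : T -> R) (x y : R) : R :=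
  E3 (fun z2 z3 z4 => kernel_h (x, y) (X z2, Y z2) (X z3, Y z3) (X z4, Y z4)).

(** Hoeffding's dependence coefficient. *)
Definition hoeffdingD (X Y : T -> R) := E (fun z => cdf_gap X Y (X z) (Y z) ^+ 2).
(** The Blum-Kiefer-Rosenblatt coefficient. *)
Definition bkrR (X Y : T -> R) := E (fun z => E (fun w => cdf_gap X Y (X z) (Y w) ^+ 2)).

Section Closure.
Context d' (T' : measurableType d').

Lemma bmfun_lcdf (X : T -> R) (k : T' -> R) : measurable_fun setT X ->
  measurable_fun setT k -> bmfun (fun w => lcdf X (k w)).
Proof. by move=> mX mk; rewrite /lcdf; bmfun. Qed.

Lemma bmfun_cdf_gap (X Y : T -> R) (k l : T' -> R) :
  measurable_fun setT X -> measurable_fun setT Y ->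
  measurable_fun setT k -> measurable_fun setT l ->
  bmfun (fun w => cdf_gap X Y (k w) (l w)).
Proof. by move=> mX mY mk ml; rewrite /cdf_gap /lcdf; bmfun. Qed.

Lemma bmfun3_comp (k1 k2 k3 : T' -> T) (g : T -> T -> T -> R) :
  bmfun3 g -> measurable_fun setT k1 -> measurable_fun setT k2 ->
  measurable_fun setT k3 -> bmfun (fun w => g (k1 w) (k2 w) (k3 w)).
Proof.
move=> bg m1 m2 m3.
apply: (@bmfun_comp _ _ _ _ _ (fun w => ((k1 w, k2 w), k3 w)) _ bg).
by do 2 (apply: measurable_fun_pair => //).
Qed.

Lemma bmfun_reduced_kernel (X Y : T -> R) (k1 k2 : T' -> R) (k3 k4 k5 : T' -> T) :
  measurable_fun setT X -> measurable_fun setT Y ->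
  measurable_fun setT k1 -> measurable_fun setT k2 ->
  measurable_fun setT k3 -> measurable_fun setT k4 -> measurable_fun setT k5 ->
  bmfun (fun w => reduced_kernel X Y (k1 w) (k2 w) (k3 w) (k4 w) (k5 w)).
Proof. by move=> mX mY m1 m2 m3 m4 m5; rewrite /reduced_kernel /sep_at; bmfun. Qed.

Lemma bmfun_kernel (p1 p2 p3 p4 : T' -> R * R) :
  measurable_fun setT p1 -> measurable_fun setT p2 ->
  measurable_fun setT p3 -> measurable_fun setT p4 ->
  bmfun (fun w => kernel_h (p1 w) (p2 w) (p3 w) (p4 w)).
Proof.
move=> m1 m2 m3 m4; under eq_fun do rewrite kernel_hE /=.
by rewrite /sep; bmfun; mfun.
Qed.

End Closure.
End Functionals.

Ltac bmfun_leaf ::= lazymatch goal with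
  | |- bmfun (fun w => reduced_kernel _ _ (@?a w) (@?b w) (@?c w) (@?d w) (@?e w)) =>
    apply: bmfun_reduced_kernel; mfun
  | |- bmfun (fun w => kernel_h (@?a w) (@?b w) (@?c w) (@?d w)) =>
    apply: bmfun_kernel; mfun
  | |- bmfun (fun w => cdf_gap _ _ _ (@?a w) (@?b w)) => apply: bmfun_cdf_gap; mfun
  | |- bmfun (fun w => lcdf _ _ (@?a w)) => apply: bmfun_lcdf; mfun
  | H : bmfun3 ?g |- bmfun (fun w => ?g (@?a w) (@?b w) (@?c w)) =>
    apply: (bmfun3_comp H); mfun
  end.

(** * Calculus of the dependence gap *)

Section Dependence.
Context {R : realType} d (T : measurableType d) (m : probability T R).
Implicit Types X Y : T -> R.
Local Notation E := (Rintegral m setT).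

Lemma cdf_gapC X Y s t : cdf_gap m X Y s t = cdf_gap m Y X t s.
Proof.
rewrite /cdf_gap mulrC; congr (_ - _).
by apply: eq_E => z; rewrite mulrC.
Qed.

Section Pair.
Variables X Y : T -> R.
Hypotheses (mX : measurable_fun setT X) (mY : measurable_fun setT Y).

(** For fixed t, the gap is the distribution function in s of X under the signed
    measure with density 1(Y < t) - F2(t). *)
Lemma cdf_gap_centered s t :
  cdf_gap m X Y s t = E (fun z => ind (X z) s * (ind (Y z) t - lcdf m Y t)).
Proof.
under [RHS]eq_Rintegral do rewrite mulrBr.
by rewrite E_B ?E_Zr//; bmfun.
Qed.

Hypothesis aX : atomless m X.

(** The product rule d(G^2) = 2 G dG in the first variable. Writing the square as
    a double integral over two copies, off ties exactly one of the two first
    coordinates is the smaller one. *)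
Lemma cdf_gap_sqr x y :
  cdf_gap m X Y x y ^+ 2 =
  2 * E (fun z => ind (X z) x * cdf_gap m X Y (X z) y * (ind (Y z) y - lcdf m Y y)).
Proof.
pose phi z := ind (Y z) y - lcdf m Y y.
pose psi z w := ind (X z) x * phi z * (ind (X w) (X z) * phi w).
have bpsi : bmfun (fun u : T * T => psi u.1 u.2) by rewrite /psi /phi; bmfun.
have bpsi' : bmfun (fun u : T * T => psi u.2 u.1) by rewrite /psi /phi; bmfun.
have Epsi : E (fun z => E (psi z)) =
    E (fun z => ind (X z) x * cdf_gap m X Y (X z) y * (ind (Y z) y - lcdf m Y y)).
  apply: eq_E => z; rewrite /psi E_Zl; last by rewrite /phi; bmfun.
  by rewrite -cdf_gap_centered// mulrAC.
have -> : cdf_gap m X Y x y ^+ 2 = E (fun z => E (fun w => psi z w + psi w z)).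
  rewrite expr2 {1}cdf_gap_centered// -E_Zr; last by bmfun.
  apply: eq_E => z; rewrite cdf_gap_centered// -E_Zl; last by bmfun.
  apply: E_ae.
  - by bmfun.
  - by rewrite /psi /phi; bmfun.
  apply: filterS (aX (X z)) => w; rewrite /psi /phi /ind.
  by case: (ltgtP (X w) (X z)) => // zw _; case: (ltP (X w) x) => wx;
    case: (ltP (X z) x) => zx //=; try ring; exfalso; lra.
transitivity (E (fun z => E (psi z)) + E (fun z => E (fun w => psi w z))).
  rewrite -E_D; [|exact: bmfun_E|exact: (@bmfun_E _ _ _ _ _ m (fun z w => psi w z))].
  apply: eq_E => z; rewrite E_D//; first exact: bmfun_sec.
  exact: (@bmfun_sec _ _ _ _ _ (fun z w => psi w z)).
by rewrite -[X in _ + X]E_swap// Epsi -mulr2n mulr_natl.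
Qed.

Lemma E_ind_gt s : E (fun z => ind s (X z)) = 1 - lcdf m X s.
Proof.
rewrite /lcdf -[X in X - _](E_cst m) -E_B; [|exact: bmfun_cst|by bmfun].
apply: E_ae; [by bmfun|by bmfun|].
apply: filterS (aX s) => z; rewrite /ind.
by case: ltgtP => // _ _; rewrite ?subr0 ?subrr.
Qed.

(** The integral of G G_u G_v: by the product rule in the first variable, the
    integrals of G^2 against dF and against dF1 dF2 become integrals of the same
    function, weighted by 1(X z < X w) and by P(X > X z). *)
Lemma E_cdf_gap_fluctuation :
  E (fun z => E (fun w => cdf_gap m X Y (X z) (Y w) *
     ((ind (X w) (X z) - lcdf m X (X z)) * (ind (Y z) (Y w) - lcdf m Y (Y w))))) =
  (bkrR m X Y - hoeffdingD m X Y) / 2.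
Proof.
pose rho z w := cdf_gap m X Y (X z) (Y w) * (ind (Y z) (Y w) - lcdf m Y (Y w)).
have brho d' (T' : measurableType d') (a b : T' -> T) :
    measurable_fun setT a -> measurable_fun setT b ->
    bmfun (fun u => rho (a u) (b u)).
  by move=> ma mb; rewrite /rho /cdf_gap /lcdf; bmfun.
have bX d' (T' : measurableType d') (a : T' -> T) : measurable_fun setT a ->
    bmfun (fun u => lcdf m X (X (a u))).
  by move=> ma; rewrite /lcdf; bmfun.
have DE : hoeffdingD m X Y = 2 * E (fun w => E (fun z => ind (X z) (X w) * rho z w)).
  rewrite -E_Zl; last by bmfun.
  apply: eq_E => w; rewrite cdf_gap_sqr; congr (2 * _).
  by apply: eq_E => z; rewrite /rho mulrA.
have RE : bkrR m X Y = 2 * E (fun w => E (fun z => (1 - lcdf m X (X z)) * rho z w)).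
  rewrite /bkrR E_swap; last by bmfun.
  rewrite -E_Zl; last by bmfun.
  apply: eq_E => w.
  under eq_Rintegral do rewrite cdf_gap_sqr.
  rewrite E_Zl; last by bmfun.
  congr (2 * _); rewrite E_swap; last first.
    by bmfun.
  apply: eq_E => z; rewrite -E_ind_gt -E_Zr; last by bmfun.
  by apply: eq_E => v; rewrite /rho mulrA.
transitivity (E (fun w => E (fun z => rho z w * (ind (X w) (X z) - lcdf m X (X z))))).
  rewrite -(@E_swap _ _ _ _ _ m m
    (fun z w => rho z w * (ind (X w) (X z) - lcdf m X (X z)))); last by bmfun.
  by apply: eq_E => z; apply: eq_E => w; rewrite /rho; ring.
rewrite RE DE -mulrBr mulrAC divff// mul1r -E_B; last 2 first.
- by bmfun.
- by bmfun.
apply: eq_E => w; rewrite -E_B; last 2 first.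
- by bmfun.
- by bmfun.
apply: E_ae.
- by bmfun.
- by bmfun.
apply: filterS (aX (X w)) => z; rewrite /rho /ind.
by case: (ltgtP (X z) (X w)) => // _ _ /=; ring.
Qed.

End Pair.
End Dependence.

(** * The projection as an integral of the reduced kernel *)

Section TripleIntegral.
Context {R : realType} d (T : measurableType d) (m : probability T R).
Local Notation E := (Rintegral m setT).
Implicit Types g h : T -> T -> T -> R.

Lemma eq_E3 g h : (forall a b c, g a b c = h a b c) -> E3 m g = E3 m h.
Proof. by move=> gh; do 3 apply: eq_E => ?. Qed.

Lemma E3_cst (k : R) : E3 m (fun _ _ _ => k) = k.
Proof.
rewrite -[RHS](E_cst m); apply: eq_E => a; rewrite -[RHS](E_cst m).
by apply: eq_E => b; rewrite E_cst.
Qed.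

Lemma E3_D g h : bmfun3 g -> bmfun3 h ->
  E3 m (fun a b c => g a b c + h a b c) = E3 m g + E3 m h.
Proof.
move=> bg bh; rewrite /E3 -E_D; [|by bmfun|by bmfun].
apply: eq_E => a /=; rewrite -E_D; [|by bmfun|by bmfun].
by apply: eq_E => b; rewrite E_D//; bmfun.
Qed.

Lemma E3_B g h : bmfun3 g -> bmfun3 h ->
  E3 m (fun a b c => g a b c - h a b c) = E3 m g - E3 m h.
Proof.
move=> bg bh; rewrite /E3 -E_B; [|by bmfun|by bmfun].
apply: eq_E => a /=; rewrite -E_B; [|by bmfun|by bmfun].
by apply: eq_E => b; rewrite E_B//; bmfun.
Qed.

Lemma E3_swap12 g : bmfun3 g -> E3 m g = E3 m (fun b a c => g a b c).
Proof.
by move=> bg; apply: (@E_swap _ _ _ _ _ m m (fun a b => E (fun c => g a b c))); bmfun.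
Qed.

Lemma E3_swap23 g : bmfun3 g -> E3 m g = E3 m (fun a c b => g a b c).
Proof.
by move=> bg; apply: eq_E => a; apply: (@E_swap _ _ _ _ _ m m (fun b c => g a b c)); bmfun.
Qed.

Lemma E_E3_swap (g : T -> T -> T -> T -> R) :
  bmfun (fun w : T * T * T * T => g w.1.1.1 w.1.1.2 w.1.2 w.2) ->
  E (fun e => E3 m (g e)) = E3 m (fun a b c => E (fun e => g e a b c)).
Proof.
move=> bg.
have bgc d' (T' : measurableType d') (k1 k2 k3 k4 : T' -> T) :
    measurable_fun setT k1 -> measurable_fun setT k2 ->
    measurable_fun setT k3 -> measurable_fun setT k4 ->
    bmfun (fun w => g (k1 w) (k2 w) (k3 w) (k4 w)).
  move=> m1 m2 m3 m4.
  apply: (@bmfun_comp _ _ _ _ _ (fun w => ((k1 w, k2 w), k3 w, k4 w)) _ bg).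
  by do 3 (apply: measurable_fun_pair => //).
transitivity (E (fun a => E (fun e => E (fun b => E (fun c => g e a b c))))).
  by apply: (@E_swap _ _ _ _ _ m m (fun e a => E (fun b => E (fun c => g e a b c)))); bmfun.
apply: eq_E => a.
transitivity (E (fun b => E (fun e => E (fun c => g e a b c)))).
  by apply: (@E_swap _ _ _ _ _ m m (fun e b => E (fun c => g e a b c))); bmfun.
by apply: eq_E => b; apply: (@E_swap _ _ _ _ _ m m (fun e c => g e a b c)); bmfun.
Qed.

Lemma ae_avoid (X : T -> R) (s : seq R) : atomless m X ->
  {ae m, forall z, all (fun r => X z != r) s}.
Proof.
move=> aX; elim: s => [|r s IH] /=; first exact: aeW.
by apply: filterS2 (aX r) IH => z -> ->.
Qed.

End TripleIntegral.

Section Projection.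
Context {R : realType} d (T : measurableType d) (m : probability T R).
Variables X Y : T -> R.
Hypotheses (mX : measurable_fun setT X) (mY : measurable_fun setT Y).
Hypotheses (aX : atomless m X) (aY : atomless m Y).

(** Off ties the kernel is the sum of the three separations minus 1/3. The three
    partitions and the two choices of the closest point in x contribute equally
    because the copies are exchangeable, whence the factor 6. *)
Lemma kernel_projE x y : kernel_proj m X Y x y =
  6 * E3 m (fun z3 z4 z2 => reduced_kernel X Y x y z2 z3 z4) - 3^-1.
Proof.
pose q a b c := reduced_kernel X Y x y a b c + reduced_kernel X Y x y a c b.
have bq : bmfun3 q by rewrite /bmfun3 /q; bmfun.
(* The second point can be paired with each of the three copies. *)
have -> : kernel_proj m X Y x y = E3 m (fun a b c => q a b c + q b a c + q c a b - 3^-1).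
  apply: E_ae; [by bmfun|by bmfun|].
  apply: filterS2 (ae_avoid [:: x] aX) (ae_avoid [:: y] aY) => z2 /= /andP[x2 _] /andP[y2 _].
  apply: E_ae; [by bmfun|by bmfun|].
  apply: filterS2 (ae_avoid [:: x; X z2] aX) (ae_avoid [:: y; Y z2] aY) => z3 /=.
  move=> /and3P[x3 x23 _] /and3P[y3 y23 _].
  apply: E_ae; [by bmfun|by bmfun|].
  apply: filterS2 (ae_avoid [:: x; X z2; X z3] aX) (ae_avoid [:: y; Y z2; Y z3] aY) => z4 /=.
  move=> /and4P[x4 x24 x34 _] /and4P[y4 y24 y34 _].
  have [? ? ?] : [/\ x != X z2, x != X z3 & x != X z4] by split; rewrite eq_sym.
  have [? ? ?] : [/\ y != Y z2, y != Y z3 & y != Y z4] by split; rewrite eq_sym.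
  have [? ? ?] : [/\ X z2 != X z3, X z2 != X z4 & X z3 != X z4] by split; rewrite eq_sym.
  have [? ? ?] : [/\ Y z2 != Y z3, Y z2 != Y z4 & Y z3 != Y z4] by split; rewrite eq_sym.
  rewrite kernel_hE /= !sep_partition// !mulr1 /q /reduced_kernel !sep_sep_at//.
  by ring.
have bq' : bmfun3 (fun a b c => q a b c + q b a c + q c a b) by rewrite /bmfun3; bmfun.
rewrite E3_B//; last by rewrite /bmfun3; bmfun.
rewrite E3_cst E3_D; [|by rewrite /bmfun3; bmfun..].
rewrite E3_D; [|by rewrite /bmfun3; bmfun..].
rewrite -(E3_swap12 m bq).
have -> : E3 m (fun a b c => q c a b) = E3 m q.
  rewrite (E3_swap23 m (g := fun a b c => q c a b)); last by rewrite /bmfun3; bmfun.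
  by rewrite -E3_swap12.
have -> : E3 m q = 2 * E3 m (reduced_kernel X Y x y).
  rewrite E3_D; [|by rewrite /bmfun3; bmfun..].
  rewrite -(E3_swap23 m (g := reduced_kernel X Y x y)); last by rewrite /bmfun3; bmfun.
  by ring.
rewrite (E3_swap12 m (g := reduced_kernel X Y x y)); last by rewrite /bmfun3; bmfun.
rewrite E3_swap23; last by rewrite /bmfun3; bmfun.
by ring.
Qed.

End Projection.

(** * The dependence identity *)

Section Identity.
Context {R : realType} d (T : measurableType d) (m : probability T R).
Local Notation E := (Rintegral m setT).
Variables X Y : T -> R.
Hypotheses (mX : measurable_fun setT X) (mY : measurable_fun setT Y).
Hypotheses (aX : atomless m X) (aY : atomless m Y).

Local Notation Dl := (cdf_gap m X Y).

Lemma E_centered_prod s t al be :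
  E (fun z => (ind (X z) s - al) * (ind (Y z) t - be)) =
  Dl s t + (al - lcdf m X s) * (be - lcdf m Y t).
Proof.
rewrite (@eq_E _ _ _ _ _ (fun z => ind (X z) s * ind (Y z) t + (al * be
   - al * ind (Y z) t - be * ind (X z) s))); last by move=> z; ring.
rewrite E_D; [|by bmfun|by bmfun].
rewrite !E_B; [|by bmfun..].
rewrite !E_Zl; [|by bmfun..].
rewrite E_cst /cdf_gap -/(lcdf m Y t) -/(lcdf m X s).
by ring.
Qed.

(** The part of the integrand without the comparison of X z integrates to zero,
    since Y z and Y w have the same law. *)
Lemma E_pair_increment s t p q :
  E (fun z => E (fun w => (ind (X z) s * p + q) * (ind (Y z) t - ind (Y w) t))) =
  p * Dl s t.
Proof.
transitivity (E (fun z => p * (ind (X z) s * (ind (Y z) t - lcdf m Y t)) +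
                          q * (ind (Y z) t - lcdf m Y t))).
  apply: eq_E => z; rewrite E_Zl; last by bmfun.
  rewrite E_B; [|by bmfun..]; rewrite E_cst -/(lcdf m Y t); ring.
rewrite E_D; [|by bmfun|by bmfun].
rewrite E_Zl; last by bmfun.
rewrite -cdf_gap_centered// E_Zl; last by bmfun.
by rewrite E_B; [rewrite E_cst -/(lcdf m Y t); ring|by bmfun|by bmfun].
Qed.

(** In the difference of the values at y and y', separation upwards and
    separation downwards combine into a single product. *)
Lemma reduced_kernelB x y y' z2 z3 z4 :
  reduced_kernel X Y x y z2 z3 z4 - reduced_kernel X Y x y' z2 z3 z4 =
  (ind x (X z3) * (ind (X z2) (X z3) - ind (X z4) (X z3)) +
   ind (X z4) (X z3) * (1 - ind (X z2) (X z3))) *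
  ((ind (Y z2) (Y z3) - ind (Y z4) (Y z3)) * (ind y (Y z3) - ind y' (Y z3)) +
   (ind (Y z2) (Y z4) - ind (Y z3) (Y z4)) * (ind y (Y z4) - ind y' (Y z4))).
Proof. by rewrite /reduced_kernel -sep_atE -!sep_atB; ring. Qed.

(** In the names of the proof, z and w are the points 1 and 5. After integrating
    them, the terms at (X z3, Y z3) give twice Hoeffding's coefficient and those
    at (X z3, Y z4) give the other coefficient plus the fluctuation integral. *)
Lemma kernel_proj_dependence :
  E (fun z => E (fun w => kernel_proj m X Y (X z) (Y z) - kernel_proj m X Y (X z) (Y w))) =
  9 * (hoeffdingD m X Y + bkrR m X Y).
Proof.
pose dr z1 z5 z3 z4 z2 :=
  reduced_kernel X Y (X z1) (Y z1) z2 z3 z4 - reduced_kernel X Y (X z1) (Y z5) z2 z3 z4.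
have bdr d' (T' : measurableType d') (k1 k2 k3 k4 k5 : T' -> T) :
    measurable_fun setT k1 -> measurable_fun setT k2 ->
    measurable_fun setT k3 -> measurable_fun setT k4 -> measurable_fun setT k5 ->
    bmfun (fun w => dr (k1 w) (k2 w) (k3 w) (k4 w) (k5 w)).
  by move=> m1 m2 m3 m4 m5; rewrite /dr; bmfun.
transitivity (E (fun z => E (fun w => 6 * E3 m (dr z w)))).
  apply: eq_E => z; apply: eq_E => w; rewrite !kernel_projE//.
  rewrite /dr E3_B; [|by rewrite /bmfun3; bmfun..].
  by rewrite opprB addrA subrK mulrBr.
transitivity (6 * E (fun z => E (fun w => E3 m (dr z w)))).
  rewrite -[RHS]E_Zl; last by rewrite /E3; bmfun.
  by apply: eq_E => z; apply: E_Zl; rewrite /E3; bmfun.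
have -> : E (fun z => E (fun w => E3 m (dr z w))) =
    E3 m (fun z3 z4 z2 => E (fun z => E (fun w => dr z w z3 z4 z2))).
  transitivity (E (fun z => E3 m (fun z3 z4 z2 => E (fun w => dr z w z3 z4 z2)))).
    by apply: eq_E => z; apply: E_E3_swap; bmfun.
  by apply: (E_E3_swap m (g := fun z z3 z4 z2 => E (fun w => dr z w z3 z4 z2))); bmfun.
have -> : E3 m (fun z3 z4 z2 => E (fun z => E (fun w => dr z w z3 z4 z2))) =
  E3 m (fun z3 z4 z2 =>
    (ind (X z2) (X z3) - ind (X z4) (X z3)) *
      ((ind (Y z2) (Y z3) - ind (Y z4) (Y z3)) * Dl (X z3) (Y z3) +
       (ind (Y z2) (Y z4) - ind (Y z3) (Y z4)) * Dl (X z3) (Y z4))).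
  apply: eq_E3 => z3 z4 z2.
  set p := ind (X z2) (X z3) - ind (X z4) (X z3).
  set u := ind (Y z2) (Y z3) - _; set v := ind (Y z2) (Y z4) - _.
  set q := ind (X z4) (X z3) * (1 - ind (X z2) (X z3)).
  pose g t z w := (ind (X z) (X z3) * p + q) * (ind (Y z) t - ind (Y w) t).
  transitivity (E (fun z => E (fun w => u * g (Y z3) z w + v * g (Y z4) z w))).
    by apply: eq_E => z; apply: eq_E => w; rewrite /dr reduced_kernelB /g /q /p /u /v; ring.
  transitivity (u * E (fun z => E (g (Y z3) z)) + v * E (fun z => E (g (Y z4) z))).
    rewrite -E_lin; [|by rewrite /g; bmfun..].
    by apply: eq_E => z; apply: E_lin; rewrite /g; bmfun.
  by rewrite /g !E_pair_increment; ring.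
(* The analogue of G G_u G_v; its two factors are integrated over z3 and z4. *)
pose J z3 z4 := Dl (X z3) (Y z4) *
  ((ind (X z4) (X z3) - lcdf m X (X z3)) * (ind (Y z3) (Y z4) - lcdf m Y (Y z4))).
have -> : E3 m (fun z3 z4 z2 =>
    (ind (X z2) (X z3) - ind (X z4) (X z3)) *
      ((ind (Y z2) (Y z3) - ind (Y z4) (Y z3)) * Dl (X z3) (Y z3) +
       (ind (Y z2) (Y z4) - ind (Y z3) (Y z4)) * Dl (X z3) (Y z4))) =
  E (fun z3 => E (fun z4 =>
     Dl (X z3) (Y z3) * (Dl (X z3) (Y z3) +
       (ind (X z4) (X z3) - lcdf m X (X z3)) * (ind (Y z4) (Y z3) - lcdf m Y (Y z3))) +
     (Dl (X z3) (Y z4) ^+ 2 + J z3 z4))).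
  apply: eq_E => z3; apply: eq_E => z4.
  transitivity (Dl (X z3) (Y z3) * E (fun z2 =>
       (ind (X z2) (X z3) - ind (X z4) (X z3)) * (ind (Y z2) (Y z3) - ind (Y z4) (Y z3)))
    + Dl (X z3) (Y z4) * E (fun z2 =>
       (ind (X z2) (X z3) - ind (X z4) (X z3)) * (ind (Y z2) (Y z4) - ind (Y z3) (Y z4)))).
    rewrite -E_lin; [|by bmfun..].
    by apply: eq_E => z2; ring.
  by rewrite !E_centered_prod /J; ring.
transitivity (6 * (2 * hoeffdingD m X Y + (bkrR m X Y + E (fun z3 => E (J z3))))); last first.
  by rewrite E_cdf_gap_fluctuation//; field.
rewrite /hoeffdingD /bkrR -[X in 6 * (X + _)]E_Zl; last by bmfun.
rewrite -[X in 6 * (_ + X)]E_D; [|by rewrite /J; bmfun..].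
rewrite -[X in _ = 6 * X]E_D; [|by rewrite /J; bmfun..].
congr (6 * _).
apply: eq_E => z3.
rewrite E_D; [|by rewrite /J; bmfun..].
rewrite [X in _ + X]E_D; [|by rewrite /J; bmfun..].
rewrite [X in X + _](_ : _ = 2 * Dl (X z3) (Y z3) ^+ 2)//.
rewrite E_Zl; last by bmfun.
rewrite E_D; [|by bmfun..].
by rewrite E_cst E_centered_prod; ring.
Qed.

End Identity.

(** * Vanishing of the dependence gap *)

Section GapVanishing.
Context {R : realType} d (T : measurableType d) (m : probability T R).
Local Notation E := (Rintegral m setT).

Lemma lcdf_itv (X : T -> R) s : measurable_fun setT X -> 0 <= lcdf m X s <= 1.
Proof.
move=> mX; apply/andP; split; first by apply: E_ge0 => z; rewrite /ind ler0n.
rewrite -[leRHS](E_cst m); apply: E_le => [||z]; [by bmfun|by bmfun|].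
by rewrite /ind; case: (_ < _).
Qed.

Lemma cdf_gap_sqr_le X Y x y : measurable_fun setT X -> measurable_fun setT Y ->
  atomless m X -> cdf_gap m X Y x y ^+ 2 <= 2 * E (fun z => `|cdf_gap m X Y (X z) y|).
Proof.
move=> mX mY aX; rewrite cdf_gap_sqr// ler_pM2l//.
apply: E_le => [||z]; [by bmfun|by bmfun|].
rewrite (le_trans (ler_norm _))// mulrAC normrM ler_piMl//.
have /andP[G0 G1] := lcdf_itv y mY.
by rewrite /ind; case: (_ < x); case: (_ < y); rewrite ler_norml;
  apply/andP; split; rewrite /=; lra.
Qed.

(** A substitute for the Cauchy-Schwarz inequality, from t <= e + t^2 / e. *)
Lemma E_norm_le_sqr (g : T -> R) e : bmfun g -> 0 < e ->
  E (fun z => `|g z|) <= e + e^-1 * E (fun z => g z ^+ 2).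
Proof.
move=> bg e0; rewrite -E_Zl; last by bmfun.
rewrite -[X in X + _](E_cst m) -E_D; [|by bmfun..].
apply: E_le => [||z]; [by bmfun|by bmfun|].
rewrite -real_normK ?num_real//; set t := `|g z|.
rewrite -(ler_pM2l e0) mulrDr mulrA divff ?gt_eqF// mul1r.
have : 0 <= t by exact: normr_ge0.
by move=> ?; nra.
Qed.

Variables X Y : T -> R.
Hypotheses (mX : measurable_fun setT X) (mY : measurable_fun setT Y).
Hypotheses (aX : atomless m X) (aY : atomless m Y).

(** Integrating the bound of G(s, Y)^2 by E |G(X, Y)| over Y shows that G(s, Y)
    vanishes in mean square for every single s; the bound in the other variable
    then gives every single t. This avoids any discussion of supports. *)
Lemma bkrR_eq0_cdf_gap s t : bkrR m X Y = 0 -> cdf_gap m X Y s t = 0.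
Proof.
move=> R0; apply/eqP; rewrite -sqrf_eq0 eq_le sqr_ge0 andbT.
have R0' : E (fun w => E (fun z => cdf_gap m X Y (X z) (Y w) ^+ 2)) = 0.
  by rewrite -R0; apply: (@E_swap _ _ _ _ _ m m (fun w z => cdf_gap m X Y (X z) (Y w) ^+ 2)); bmfun.
have b1 : E (fun w => E (fun z => `|cdf_gap m X Y (X z) (Y w)|)) <= 0.
  apply/ler_addgt0Pr => e e0; rewrite add0r.
  rewrite -[leRHS]addr0 -[X in _ + X](mulr0 e^-1) -R0' -E_Zl; last by bmfun.
  rewrite -[X in X + _](E_cst m) -E_D; [|by bmfun..].
  apply: E_le => [||w]; [by bmfun|by bmfun|].
  by apply: E_norm_le_sqr => //; bmfun.
have b2 : E (fun w => cdf_gap m X Y s (Y w) ^+ 2) <= 0.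
  rewrite (@le_trans _ _ (2 * E (fun w => E (fun z => `|cdf_gap m X Y (X z) (Y w)|))))//.
    rewrite -E_Zl; last by bmfun.
    apply: E_le => [||w]; [by bmfun|by bmfun|].
    exact: cdf_gap_sqr_le.
  by rewrite pmulr_rle0.
apply/ler_addgt0Pr => e e0; rewrite add0r.
have e2 : 0 < e / 2 by rewrite divr_gt0.
rewrite (@le_trans _ _ (2 * E (fun w => `|cdf_gap m X Y s (Y w)|)))//.
  rewrite cdf_gapC; under [X in 2 * X]eq_Rintegral do rewrite cdf_gapC.
  exact: cdf_gap_sqr_le.
rewrite -ler_pdivlMl// mulrC (le_trans (E_norm_le_sqr _ e2))//; first by bmfun.
by rewrite gerDl pmulr_rle0// invr_gt0.
Qed.

(** The product form of A and B matters: it makes (X z, Y w) fall into the region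
    of constancy for independent z and w. *)
Lemma kernel_proj_const_cdf_gap (A B : set R) k s t :
  {ae m, forall z, A (X z) /\ B (Y z)} ->
  (forall x y, A x -> B y -> kernel_proj m X Y x y = k) ->
  cdf_gap m X Y s t = 0.
Proof.
move=> XA hk; apply: bkrR_eq0_cdf_gap.
have D0 : 0 <= hoeffdingD m X Y by apply: E_ge0 => z; exact: sqr_ge0.
have R0 : 0 <= bkrR m X Y.
  by apply: E_ge0 => z; apply: E_ge0 => w; exact: sqr_ge0.
suff : 9 * (hoeffdingD m X Y + bkrR m X Y) = 0 by lra.
rewrite -kernel_proj_dependence// -[RHS](E_cst m).
have bh d' (T' : measurableType d') (k1 k2 : T' -> T) : measurable_fun setT k1 ->
    measurable_fun setT k2 -> bmfun (fun w => kernel_proj m X Y (X (k1 w)) (Y (k2 w))).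
  by move=> m1 m2; rewrite /kernel_proj /E3; bmfun.
apply: E_ae; [by bmfun|by bmfun|].
apply: filterS (XA) => z [Az Bz].
rewrite -[RHS](E_cst m); apply: E_ae; [by bmfun|by bmfun|].
by apply: filterS (XA) => w [Aw Bw]; rewrite !hk// subrr.
Qed.

End GapVanishing.

(** * Independence and joint laws *)

Section Independence.
Context {R : realType} d (T : measurableType d) (m : probability T R).
Local Notation E := (Rintegral m setT).

(** Packages a measurable function, to make its law a probability measure. *)
Definition mfun_of d2 (S : measurableType d2) (k : T -> S)
    (mk : measurable_fun setT k) : {mfun T >-> S} :=
  MeasurableFun.Pack (MeasurableFun.Class (isMeasurableFun.Build _ _ _ _ k mk)).

(** Both sides are finite measures in A, so it is enough that they agree on a
    generating family that is stable under intersection. *)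
Lemma independent_generator d2 (S : measurableType d2) (G : set (set S))
    (X : T -> S) (D : set T) :
  measurable = <<s G >> -> setI_closed G ->
  (exists2 g : (set S)^nat, (forall i, G (g i)) & \bigcup_i g i = setT) ->
  measurable_fun setT X -> measurable D ->
  (forall A, G A -> m (X @^-1` A `&` D) = m (X @^-1` A) * m D)%E ->
  forall A, measurable A -> (m (X @^-1` A `&` D) = m (X @^-1` A) * m D)%E.
Proof.
move=> GE GI [g Gg gT] mX mD GX A mA.
have r0 : 0 <= fine (m D) by rewrite fine_ge0.
have rE : (fine (m D))%:E = m D by rewrite fineK// fin_num_measure.
pose m1 := (pushforward (mrestr m mD) X : {measure set S -> \bar R}).
pose m2 : {measure set S -> \bar R} :=
  mscale (NngNum r0) (distribution m (mfun_of mX)).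
have := @measure_unique _ _ _ G g GE GI Gg gT (m1 mX) m2.
have m2E B : m2 B = (m (X @^-1` B) * m D)%E.
  by rewrite /m2 /= /mscale /= rE muleC.
move=> /(_ _ _ A mA); rewrite m2E; apply.
- by move=> B GB; rewrite m2E -GX.
- move=> k; rewrite /m1 /= /pushforward /mrestr.
  rewrite (@le_lt_trans _ _ 1%E) ?ltry//; apply: probability_le1.
  apply: measurableI => //; rewrite -[X in measurable X]setTI; apply: (mX) => //.
  by rewrite GE; apply: sub_sigma_algebra.
Qed.

Variables X Y : T -> R.
Hypotheses (mX : measurable_fun setT X) (mY : measurable_fun setT Y).

Lemma ray_generator : let G : set (set R) := @RGenInftyO.G R in
  [/\ @measurable _ R = <<s G >>, setI_closed G &
      exists2 g : (set R)^nat, (forall i, G (g i)) & \bigcup_i g i = setT].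
Proof.
split.
- exact: RGenInftyO.measurableE.
- move=> _ _ [x ->] [y ->]; exists (Num.min x y).
  by apply/seteqP; split => z /=; rewrite !in_itv/= lt_min; [case=> -> ->|case/andP].
- exists (fun n : nat => `]-oo, (n%:R : R)[%classic); first by move=> n; exists n%:R.
  rewrite -subTset => x _; exists (Num.trunc `|x|).+1 => //=.
  rewrite in_itv/= (le_lt_trans (ler_norm _))//.
  exact: truncnS_gt.
Qed.

Lemma E_indic D : measurable D -> E (\1_D) = fine (m D).
Proof. by move=> mD; rewrite /Rintegral integral_indic// setIT. Qed.

Lemma indE (z s : R) : ind z s = \1_(`]-oo, s[%classic) z.
Proof.
by rewrite /ind indicE mem_setE in_itv.
Qed.

Lemma measurable_preimage (Z : T -> R) A : measurable_fun setT Z -> measurable A ->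
  measurable (Z @^-1` A).
Proof. by move=> mZ mA; rewrite -[X in measurable X]setTI; apply: mZ. Qed.

Lemma cdf_gap_eq0_independent : (forall s t, cdf_gap m X Y s t = 0) ->
  independent_pair m X Y.
Proof.
move=> D0; have [mE GI cov] := ray_generator.
have mray t : measurable (`]-oo, t[%classic : set R) by exact: measurable_itv.
have rays s t : (m (X @^-1` `]-oo, s[ `&` Y @^-1` `]-oo, t[) =
    m (X @^-1` `]-oo, s[) * m (Y @^-1` `]-oo, t[))%E.
  have mXs := measurable_preimage mX (mray s).
  have mYt := measurable_preimage mY (mray t).
  have := D0 s t; rewrite /cdf_gap /lcdf.
  rewrite (@eq_E _ _ _ m _ (\1_(X @^-1` `]-oo, s[ `&` Y @^-1` `]-oo, t[))); last first.
    by move=> z; rewrite !indE indicI.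
  rewrite (@eq_E _ _ _ m (fun z => ind (X z) s) (\1_(X @^-1` `]-oo, s[))); last first.
    by move=> z; rewrite indE.
  rewrite (@eq_E _ _ _ m (fun z => ind (Y z) t) (\1_(Y @^-1` `]-oo, t[))); last first.
    by move=> z; rewrite indE.
  rewrite !E_indic//; last exact: measurableI.
  move=> /subr0_eq e; have {e} := congr1 (fun r : R => r%:E) e.
  by rewrite EFinM !fineK// ?fin_num_measure//; exact: measurableI.
move=> A B mA mB.
have XB s : (m (X @^-1` `]-oo, s[ `&` Y @^-1` B) =
    m (X @^-1` `]-oo, s[) * m (Y @^-1` B))%E.
  rewrite setIC muleC; apply: (independent_generator mE GI cov) => //.
    exact: measurable_preimage.
  by move=> _ [t ->]; rewrite setIC rays muleC.
apply: (independent_generator mE GI cov) => //.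
  exact: measurable_preimage.
by move=> _ [s ->].
Qed.

End Independence.

Section JointLaw.
Context {R : realType}.

Lemma E_pushforward d d2 (T : measurableType d) (S : measurableType d2)
    (P : probability T R) (mu : probability S R) (k : T -> S) (g : S -> R) :
  measurable_fun setT k ->
  (forall A, measurable A -> P (k @^-1` A) = mu A) -> bmfun g ->
  Rintegral P setT (fun w => g (k w)) = Rintegral mu setT g.
Proof.
move=> mk kmu bg; have bgk : bmfun (fun w => g (k w)) by exact: bmfun_comp bg mk.
apply: EFin_inj; rewrite !bmfun_EFin_E//.
rewrite -(@integral_distribution _ _ _ _ _ P (mfun_of mk) (fun y => (g y)%:E)).
- by apply: eq_measure_integral => A mA _; exact: kmu.
- by apply/measurable_EFinP; case: bg.
- exact: (bmfun_integrable P bgk).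
Qed.

Lemma E_joint d d1 d2 (T : measurableType d) (S1 : measurableType d1)
    (S2 : measurableType d2) (P : probability T R)
    (mu1 : probability S1 R) (mu2 : probability S2 R)
    (k1 : T -> S1) (k2 : T -> S2) (g : S1 -> S2 -> R) :
  measurable_fun setT k1 -> measurable_fun setT k2 ->
  (forall A B, measurable A -> measurable B ->
    P (k1 @^-1` A `&` k2 @^-1` B) = mu1 A * mu2 B)%E ->
  bmfun (fun w : S1 * S2 => g w.1 w.2) ->
  Rintegral P setT (fun w => g (k1 w) (k2 w)) =
  Rintegral mu1 setT (fun x => Rintegral mu2 setT (g x)).
Proof.
move=> mk1 mk2 kmu bg; rewrite -E_prod//.
have mk : measurable_fun setT (fun w => (k1 w, k2 w)) by exact: measurable_fun_pair.
rewrite -(@E_pushforward _ _ _ _ P (mu1 \x mu2)%E (fun w => (k1 w, k2 w)) (fun w => g w.1 w.2))//.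
move=> A mA; symmetry.
by apply: (@product_measure_unique _ _ _ _ _ mu1 mu2 (distribution P (mfun_of mk))).
Qed.

End JointLaw.

(** * Variance and projection for i.i.d. copies *)

Section Variance.
Context {R : realType} d (T : measurableType d) (P : probability T R).

(** The variance is the integral of a nonnegative square. *)
Lemma variance_le0_ae_cst (H : T -> R) : bmfun H -> ('V_P[H] <= 0)%E ->
  exists c, {ae P, forall w, H w = c}.
Proof.
move=> bH; rewrite /variance unlock; set c := fine _; rewrite unlock => V0.
exists c.
have bHc : bmfun (fun w => (H w - c) ^+ 2) by bmfun.
have I0 : (\int[P]_w `|((H w - c) ^+ 2)%:E| = 0)%E.
  apply/eqP; rewrite eq_le; apply/andP; split; last exact: integral_ge0.
  apply: le_trans V0; rewrite le_eqVlt; apply/orP; left; apply/eqP.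
  by apply: eq_integral => w _ /=; rewrite ger0_norm ?sqr_ge0// expr2.
have mHc : measurable_fun setT (fun w => ((H w - c) ^+ 2)%:E).
  by apply/measurable_EFinP; case: bHc.
have := (ae_eq_integral_abs P measurableT mHc).1 I0.
apply: filterS => w /(_ Logic.I)/= [] /eqP.
by rewrite sqrf_eq0 subr_eq0 => /eqP.
Qed.

End Variance.

Section ProjectionOfCopies.
Context {R : realType} d0 (T0 : measurableType d0) (P0 : probability T0 R)
  (XY : {RV P0 >-> (R * R)%type}).
Context d1 (T : measurableType d1) (P : probability T R)
  (Z : 'I_4 -> {RV P >-> (R * R)%type}).
Hypothesis Z_iid : iid_copies XY Z.

Let mu : probability (R * R)%type R := distribution P0 XY.

Let mZ i : measurable_fun setT (Z i : T -> R * R).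
Proof. exact: measurable_funPT. Qed.

Let lawZ i A : measurable A -> P (Z i @^-1` A) = mu A.
Proof. by move=> mA; apply: Z_iid.2. Qed.

Lemma independent_three (A B C : set (R * R)) :
  measurable A -> measurable B -> measurable C ->
  P (Z (inord 1) @^-1` A `&` (Z (inord 2) @^-1` B `&` Z (inord 3) @^-1` C)) =
  (mu A * (mu B * mu C))%E.
Proof.
move=> mA mB mC; have [indep _] := Z_iid.
(* The point with index 0 is left unconstrained. *)
pose D (i : 'I_4) := nth setT [:: setT; A; B; C] i.
have mD i : measurable (D i).
  by rewrite /D; case: i => [[|[|[|[|//]]]] ?] /=.
have i1 : inord 1 = lift ord0 ord0 :> 'I_4 by apply: val_inj; rewrite /= inordK.
have i2 : inord 2 = lift ord0 (lift ord0 ord0) :> 'I_4.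
  by apply: val_inj; rewrite /= inordK.
have i3 : inord 3 = lift ord0 (lift ord0 (lift ord0 ord0)) :> 'I_4.
  by apply: val_inj; rewrite /= inordK.
have := indep [set: 'I_4]%SET D mD.
rewrite big_mkcond /= !big_ord_recl big_ord0 !inE /D /=.
rewrite preimage_setT probability_setT mul1e mule1.
rewrite -i1 -i2 -i3 !lawZ// => <-; congr (P _).
apply/seteqP; split => w /=.
  move=> [Aw [Bw Cw]] i _; case: i => [[|[|[|[|//]]]] ip] //=.
  - by rewrite (_ : Ordinal ip = inord 1)//; apply: val_inj; rewrite /= inordK.
  - by rewrite (_ : Ordinal ip = inord 2)//; apply: val_inj; rewrite /= inordK.
  - by rewrite (_ : Ordinal ip = inord 3)//; apply: val_inj; rewrite /= inordK.
move=> h; split; [|split].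
- by have := h (inord 1) (finset.in_setT _); rewrite /preimage /= inordK.
- by have := h (inord 2) (finset.in_setT _); rewrite /preimage /= inordK.
- by have := h (inord 3) (finset.in_setT _); rewrite /preimage /= inordK.
Qed.

(** The pair of the last two copies has the product law, and is independent of the
    first one; the latter is checked on rectangles. *)
Lemma proj_h1E p : proj_h1 Z p = kernel_proj mu fst snd p.1 p.2.
Proof.
pose g (a : R * R) (bc : (R * R) * (R * R)) := kernel_h p a bc.1 bc.2.
have bg : bmfun (fun w : (R * R) * ((R * R) * (R * R)) => g w.1 w.2).
  by rewrite /g; bmfun.
have mZ23 : measurable_fun setT (fun w => (Z (inord 2) w, Z (inord 3) w)).
  exact: measurable_fun_pair.
have law23 C : measurable C ->
    P ((fun w => (Z (inord 2) w, Z (inord 3) w)) @^-1` C) = (mu \x mu)%E C.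
  move=> mC; symmetry.
  apply: (@product_measure_unique _ _ _ _ _ mu mu (distribution P (mfun_of mZ23))) => //.
  move=> A B mA mB; have := independent_three measurableT mA mB.
  by rewrite preimage_setT setTI probability_setT mul1e.
rewrite /proj_h1 unlock.
transitivity (Rintegral P setT (fun w => g (Z (inord 1) w) (Z (inord 2) w, Z (inord 3) w))) => //.
transitivity (Rintegral mu setT (fun a => Rintegral (mu \x mu)%E setT (g a))).
  apply: (@E_joint _ _ _ _ _ _ _ P mu (mu \x mu)%E (Z (inord 1))
    (fun w => (Z (inord 2) w, Z (inord 3) w)) g) => //.
  move=> A C mA mC.
  transitivity (P ((fun w => (Z (inord 2) w, Z (inord 3) w)) @^-1` C) *
                P (Z (inord 1) @^-1` A))%E; last first.
    by rewrite muleC; congr (_ * _)%E; [exact: lawZ|exact: law23].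
  rewrite setIC.
  have mZA : measurable (Z (inord 1) @^-1` A).
    by rewrite -[X in measurable X]setTI; exact: mZ.
  apply: (@independent_generator _ _ _ P _ _
    [set A `*` B | A in measurable & B in measurable]) => //.
  - exact: measurable_prod_measurableType.
  - move=> _ _ [A1 mA1 [B1 mB1 <-]] [A2 mA2 [B2 mB2 <-]].
    exists (A1 `&` A2); first exact: measurableI.
    by exists (B1 `&` B2); [exact: measurableI|rewrite setXI].
  - exists (fun=> setT); last by rewrite bigcup_const.
    by move=> _; exists setT => //; exists setT => //; rewrite setXTT.
  - move=> _ [B mB [C' mC' <-]]; rewrite setIC.
    rewrite lawZ// (_ : P (_ @^-1` (B `*` C')) = mu B * mu C')%E; last first.
      by rewrite law23 ?product_measure1E//; exact: measurableX.
    by rewrite muleC -independent_three.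
rewrite /kernel_proj /E3; apply: eq_E => a.
transitivity (Rintegral mu setT (fun b => Rintegral mu setT (fun c => g a (b, c)))).
  rewrite -(@E_prod _ _ _ _ _ mu mu (fun b c => g a (b, c))).
    by apply: eq_E => -[b c].
  exact: (bmfun_sec a bg).
apply: eq_E => b; apply: eq_E => c; rewrite /g /=.
by rewrite -!surjective_pairing.
Qed.

End ProjectionOfCopies.

(** * Continuity of the projection *)

Section Continuity.
Context {R : realType}.

(** Comparisons are locally constant away from ties, hence so is the kernel. *)
Lemma near_ind_eq (u : nat -> R) (x r : R) : u @ \oo --> x -> r != x ->
  \forall n \near \oo, ind (u n) r = ind x r /\ ind r (u n) = ind r x.
Proof.
move=> ux rx; rewrite /ind.
have [xr|xr|xr] := ltgtP x r; last by rewrite xr eqxx in rx.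
- apply: filterS (cvgr_lt x ux r xr) => n un.
  by rewrite un (lt_gtF un).
- apply: filterS (cvgr_gt x ux r xr) => n un.
  by rewrite un (lt_gtF un).
Qed.

Lemma near_sep_eq (u : nat -> R) (x r s t : R) : u @ \oo --> x ->
  r != x -> s != x -> t != x ->
  \forall n \near \oo, sep (u n) r s t = sep x r s t.
Proof.
move=> ux rx sx tx; rewrite /sep.
have Hs := near_ind_eq ux sx; have Ht := near_ind_eq ux tx.
by apply: filterS2 Hs Ht => n [-> ->] [-> ->].
Qed.

Lemma kernel_h_cvg (u : nat -> R * R) (p p2 p3 p4 : R * R) :
  (fun n => (u n).1) @ \oo --> p.1 -> (fun n => (u n).2) @ \oo --> p.2 ->
  p2.1 != p.1 -> p3.1 != p.1 -> p4.1 != p.1 ->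
  p2.2 != p.2 -> p3.2 != p.2 -> p4.2 != p.2 ->
  (fun n => kernel_h (u n) p2 p3 p4) @ \oo --> kernel_h p p2 p3 p4.
Proof.
move=> ux uy x2 x3 x4 y2 y3 y4; apply: cvg_near_cst.
have X1 := near_sep_eq ux x2 x3 x4; have X2 := near_sep_eq ux x3 x2 x4.
have X3 := near_sep_eq ux x4 x2 x3; have Y1 := near_sep_eq uy y2 y3 y4.
have Y2 := near_sep_eq uy y3 y2 y4; have Y3 := near_sep_eq uy y4 y2 y3.
near=> n; rewrite !kernel_hE.
rewrite (near X1 n)// (near X2 n)// (near X3 n)//.
by rewrite (near Y1 n)// (near Y2 n)// (near Y3 n).
Unshelve. all: by end_near. Qed.

Context d (T : measurableType d) (P : probability T R).
Variables Z2 Z3 Z4 : T -> R * R.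
Hypotheses (mZ2 : measurable_fun setT Z2) (mZ3 : measurable_fun setT Z3)
  (mZ4 : measurable_fun setT Z4).

Lemma E_kernel_h_cvg (u : nat -> R * R) (p : R * R) :
  (fun n => (u n).1) @ \oo --> p.1 -> (fun n => (u n).2) @ \oo --> p.2 ->
  (forall Z, [\/ Z = Z2, Z = Z3 | Z = Z4] ->
     atomless P (fun w => (Z w).1) /\ atomless P (fun w => (Z w).2)) ->
  (fun n => Rintegral P setT (fun w => kernel_h (u n) (Z2 w) (Z3 w) (Z4 w)))
  @ \oo --> Rintegral P setT (fun w => kernel_h p (Z2 w) (Z3 w) (Z4 w)).
Proof.
move=> ux uy aZ.
pose g (p : R * R) (q : (R * R) * (R * R) * (R * R)) := kernel_h p q.1.1 q.1.2 q.2.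
have [_ [M gM]] : bmfun (fun w : (R * R) * ((R * R) * (R * R) * (R * R)) => g w.1 w.2).
  by rewrite /g; bmfun.
have bk q : bmfun (fun w => kernel_h q (Z2 w) (Z3 w) (Z4 w)) by bmfun.
pose F n w := (kernel_h (u n) (Z2 w) (Z3 w) (Z4 w))%:E.
pose F0 w := (kernel_h p (Z2 w) (Z3 w) (Z4 w))%:E.
have mF n : measurable_fun setT (F n) by apply/measurable_EFinP; case: (bk (u n)).
have mF0 : measurable_fun setT F0 by apply/measurable_EFinP; case: (bk p).
have iM : P.-integrable setT (cst M%:E) by exact: finite_measure_integrable_cst.
have FF0 : {ae P, forall w, setT w -> F ^~ w @ \oo --> F0 w}.
  have [a2 b2] := aZ Z2 (Or31 _ _ erefl).
  have [a3 b3] := aZ Z3 (Or32 _ _ erefl).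
  have [a4 b4] := aZ Z4 (Or33 _ _ erefl).
  apply: filterS2 (filterI (filterI (a2 p.1) (a3 p.1)) (a4 p.1))
                  (filterI (filterI (b2 p.2) (b3 p.2)) (b4 p.2)) => w.
  move=> [[? ?] ?] [[? ?] ?] _; apply: cvg_EFin; first exact: nearW.
  exact: kernel_h_cvg.
have FM : {ae P, forall w n, setT w -> (`|F n w| <= cst M%:E w)%E}.
  by apply: aeW => w n _; rewrite lee_fin; exact: (gM (u n, (Z2 w, Z3 w, Z4 w))).
have [_ _] := dominated_convergence measurableT mF mF0 FF0 iM FM.
rewrite /F0 -bmfun_EFin_E// => h.
exact: fine_cvg h.
Qed.

End Continuity.

(** * Laws with a continuous density *)

Section Density.
Context {R : realType} d0 (T0 : measurableType d0) (P0 : probability T0 R)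
  (XY : {RV P0 >-> (R * R)%type}) (f : R * R -> R).
Hypothesis f_density : is_density XY f.
Let mu : probability (R * R)%type R := distribution P0 XY.
Let leb2 := ((@lebesgue_measure R) \x (@lebesgue_measure R))%E.

Let f_measurable (D : set (R * R)) : measurable_fun D (fun z => (f z)%:E).
Proof.
by have [mf _ _] := f_density; apply/measurable_EFinP; exact: measurable_funTS.
Qed.

Let muE A : measurable A -> mu A = (\int[leb2]_(z in A) (f z)%:E)%E.
Proof. by have [_ _ fE] := f_density; exact: fE. Qed.

Let leb2E (A B : set R) : measurable A -> measurable B ->
  leb2 (A `*` B) = (lebesgue_measure A * lebesgue_measure B)%E.
Proof.
move=> mA mB.
exact (@product_measure1E _ _ _ _ _ (@lebesgue_measure R) (@lebesgue_measure R) A B mA mB).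
Qed.

Let leb2_eq0 (A : set (R * R)) : measurable A -> (forall z, A z -> 0 < f z) ->
  (\int[leb2]_(z in A) (f z)%:E = 0)%E -> leb2 A = 0%E.
Proof.
move=> mA fA I0.
have abs0 : (\int[leb2]_(z in A) `|(f z)%:E| = 0)%E.
  rewrite -[RHS]I0; apply: eq_integral => z /set_mem Az /=.
  by rewrite gtr0_norm ?fA.
have [M [mM M0 AM]] := (ae_eq_integral_abs
  ((@lebesgue_measure R) \x (@lebesgue_measure R))%E mA (f_measurable (D := A))).1 abs0.
apply/eqP; rewrite eq_le measure_ge0 andbT -M0; apply: le_measure; rewrite ?inE// => z Az.
by apply: AM => /= /(_ Az) [] fz; have := fA _ Az; rewrite fz ltxx.
Qed.

Lemma density_null (A : set (R * R)) : measurable A -> leb2 A = 0%E -> mu A = 0%E.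
Proof.
move=> mA A0; rewrite muE//; apply: null_set_integral => //; exact: f_measurable.
Qed.

Lemma density_atomless_fst : atomless mu fst.
Proof.
move=> s; exists ([set s] `*` setT); split.
- exact: measurableX.
- apply: density_null; first exact: measurableX.
  by rewrite leb2E// lebesgue_measure_set1 mul0e.
- by move=> [x y] /= /negP; rewrite negbK => /eqP ->.
Qed.

Lemma density_atomless_snd : atomless mu snd.
Proof.
move=> s; exists (setT `*` [set s]); split.
- exact: measurableX.
- apply: density_null; first exact: measurableX.
  by rewrite leb2E// lebesgue_measure_set1 mule0.
- by move=> [x y] /= /negP; rewrite negbK => /eqP ->.
Qed.

Lemma density_ae_support D : measurable D -> f @^-1` `]0, +oo[ `<=` D ->
  {ae mu, forall z, D z}.
Proof.
move=> mD fD; exists (~` D); split => //; first exact: measurableC.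
have [_ f0 _] := f_density; rewrite muE; last exact: measurableC.
rewrite (eq_integral (cst 0%E)) ?integral0// => z /set_mem /= nDz.
congr (_%:E); apply/eqP; rewrite eq_le f0 andbT leNgt; apply/negP => fz.
by apply: nDz; apply: fD; rewrite /= in_itv/= fz.
Qed.

Hypothesis f_cont : continuous f.

(** A small ball around a point of {f > 0} has positive Lebesgue measure and a
    positive density, hence is not null. *)
Lemma density_dense N p e : measurable N -> mu N = 0%E ->
  closure (f @^-1` `]0, +oo[) p -> 0 < e -> exists2 q, ball p e q & ~ N q.
Proof.
move=> mN N0 clp e0; have [q [/= fq pq]] := clp _ (nbhsx_ballx p e e0).
have : nbhs q (ball p e `&` f @^-1` `]0, +oo[).
  apply: filterI.
    by apply: open_nbhs_nbhs; split => //; exact: ball_open.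
  apply: f_cont; apply: open_nbhs_nbhs; split => //; exact: itv_open.
move=> /nbhs_ballP[r /= r0 Br].
apply: contrapT => /forall2NP H.
have BN : ball q r `<=` N.
  by move=> z /Br[pz _]; have [//|/contrapT] := H z.
have BE : ball q r = ball q.1 r `*` ball q.2 r by [].
have mB : measurable (ball q r).
  by rewrite BE; apply: measurableX; exact: measurable_ball.
have muB : mu (ball q r) = 0%E.
  by apply/eqP; rewrite eq_le measure_ge0 andbT -N0; apply: le_measure; rewrite ?inE.
have : leb2 (ball q r) = 0%E.
  apply: leb2_eq0 => //; last by rewrite -muE.
  by move=> z /Br[_ /=]; rewrite in_itv/= andbT.
rewrite BE leb2E; [|exact: measurable_ball..].
rewrite !lebesgue_measure_ball ?ltW// -EFinM => -[] /eqP.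
by apply/negP; rewrite gt_eqF// mulr_gt0// mulrn_wgt0.
Qed.

End Density.

Lemma ae_law {R : realType} d d2 (T : measurableType d) (S : measurableType d2)
    (P : probability T R) (mu : probability S R) (k : T -> S) (Q : S -> Prop) :
  measurable_fun setT k -> (forall A, measurable A -> P (k @^-1` A) = mu A) ->
  {ae mu, forall z, Q z} -> {ae P, forall w, Q (k w)}.
Proof.
move=> mk kmu [N [mN N0 QN]]; exists (k @^-1` N); split.
- by rewrite -[X in measurable X]setTI; exact: mk.
- by rewrite kmu.
- by move=> w nQ; apply: QN.
Qed.

Unset Implicit Arguments.
Set Strict Implicit.
Set Printing Implicit Defensive.

Theorem theorem3p4 (R : realType)
    (d0 : measure_display) (T0 : measurableType d0) (P0 : probability T0 R)
    (XY : {RV P0 >-> (R * R)%type}) (f : R * R -> R) (a b c d : \bar R)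
    (hab : (a < b)%E) (hcd : (c < d)%E)
    (f_cont : continuous f) (f_density : is_density XY f)
    (f_supp : closure (f @^-1` `]0, +oo[) =
              (EFin @^-1` `[a, b]) `*` (EFin @^-1` `[c, d]))
    (d1 : measure_display) (T : measurableType d1) (P : probability T R)
    (Z : 'I_4 -> {RV P >-> (R * R)%type}) (Z_iid : iid_copies XY Z)
    (XY_dep : ~ independent_pair P0 (fun w => (XY w).1) (fun w => (XY w).2)) :
  (0 < 'V_P[fun w => proj_h1 Z (Z (inord 0) w)])%E.
Proof.
pose mu : probability (R * R)%type R := distribution P0 XY.
have mZ i : measurable_fun setT (Z i : T -> R * R) by exact: measurable_funPT.
have lawZ i A : measurable A -> P (Z i @^-1` A) = mu A by move=> mA; apply: Z_iid.2.
rewrite ltNge; apply/negP => V0; apply: XY_dep.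
have bproj : bmfun (proj_h1 Z).
  rewrite (_ : proj_h1 Z = fun p => kernel_proj mu fst snd p.1 p.2); last first.
    by apply/funext => p; exact: proj_h1E.
  by rewrite /kernel_proj /E3; bmfun.
have bH : bmfun (fun w => proj_h1 Z (Z (inord 0) w)) := bmfun_comp bproj (mZ _).
have [k Hk] := variance_le0_ae_cst bH V0.
pose N := [set p | proj_h1 Z p != k].
have mN : measurable N.
  rewrite (_ : N = ~` (proj_h1 Z @^-1` [set k])); last first.
    by apply/seteqP; split => p /= /eqP.
  apply: measurableC; rewrite -[X in measurable X]setTI.
  by case: bproj => m _; apply: m.
have N0 : mu N = 0%E.
  rewrite -(lawZ (inord 0))//.
  have [M [mM M0 HM]] := Hk.
  apply/eqP; rewrite eq_le measure_ge0 andbT -M0; apply: le_measure.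
  - by rewrite inE -[X in measurable X]setTI; exact: mZ.
  - by rewrite inE.
  - by move=> w /= /eqP Nw; apply: HM.
pose A : set R := EFin @^-1` `[a, b].
pose B : set R := EFin @^-1` `[c, d].
have hk p : (A `*` B) p -> proj_h1 Z p = k.
  rewrite -f_supp => clp.
  (* Points outside the exceptional set approximate p, and h1 is continuous. *)
  have /choice[u hu] (n : nat) : exists q, ball p n.+1%:R^-1 q /\ ~ N q.
    have n0 : 0 < (n.+1%:R : R)^-1 by rewrite invr_gt0.
    by have [q ? ?] := density_dense f_density f_cont mN N0 clp n0; exists q.
  have u1 : (fun n => (u n).1) @ \oo --> p.1.
    apply/cvgrPdist_lt => e e0; near=> n.
    have [[pu _] _] := hu n; apply: lt_trans pu _.
    by near: n; exact: near_infty_natSinv_lt (PosNum e0).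
  have u2 : (fun n => (u n).2) @ \oo --> p.2.
    apply/cvgrPdist_lt => e e0; near=> n.
    have [[_ pu] _] := hu n; apply: lt_trans pu _.
    by near: n; exact: near_infty_natSinv_lt (PosNum e0).
  have aZ (g : T -> R * R) :
      [\/ g = Z (inord 1), g = Z (inord 2) | g = Z (inord 3)] ->
      atomless P (fun w => (g w).1) /\ atomless P (fun w => (g w).2).
    move=> gZ; have [i ->] : exists i, g = Z i.
      by case: gZ => ->; eexists.
    split=> s.
    - apply: (ae_law (Q := fun z => z.1 != s) (mZ i) (lawZ i)).
      exact: density_atomless_fst f_density s.
    - apply: (ae_law (Q := fun z => z.2 != s) (mZ i) (lawZ i)).
      exact: density_atomless_snd f_density s.
  have Hcvg : (fun n => proj_h1 Z (u n)) @ \oo --> proj_h1 Z p.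
    rewrite /proj_h1 unlock.
    exact: (E_kernel_h_cvg (mZ _) (mZ _) (mZ _) u1 u2 aZ).
  have kcvg : (fun n => proj_h1 Z (u n)) @ \oo --> k.
    apply: cvg_near_cst; apply: nearW => n; have [_ Nu] := hu n.
    by apply/eqP; apply: contrapT => /negP.
  exact: cvg_unique Hcvg kcvg.
have mA (x y : \bar R) : measurable (EFin @^-1` `[x, y] : set R).
  by rewrite -[X in measurable X]setTI; apply: EFin_measurable => //; exact: emeasurable_itv.
have mu_supp : {ae mu, forall z, A z.1 /\ B z.2}.
  apply: (density_ae_support f_density (D := A `*` B)).
    by apply: measurableX; exact: mA.
  by rewrite -f_supp; exact: subset_closure.
have indep : independent_pair mu fst snd.
  apply: cdf_gap_eq0_independent => // s t.
  apply: (@kernel_proj_const_cdf_gap _ _ _ _ _ _ _ _ _ _ A B k) => //.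
  - exact: density_atomless_fst f_density.
  - exact: density_atomless_snd f_density.
  - by move=> x y Ax By; rewrite -(proj_h1E Z_iid (x, y)); exact: hk.
exact: indep.
Unshelve. all: by end_near. Qed.
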